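(* Let $R$ be a commutative ring with unity, let $Y \subseteq \mathrm{Spec}(R)$, and suppose $\bigcap Y = \{0\}$. The following statements are equivalent. (a) Every proper ideal of $R$ is a relative strong $\mathcal{H}_Y$-ideal. (b) Every proper ideal of $R$ is a relative $\mathcal{H}_Y$-ideal. (c) $R$ is a (von Neumann) regular ring.
   Context: For $S\subseteq R$ and $a\in R$, $h_Y(S)=\{P\in Y: S\subseteq P\}$ and $h_Y(a)=h_Y(\{a\})$. For $T\subseteq Y$, $k(T)=\bigcap_{P\in T}P$ (with $k(\emptyset)=R$), and $kh_Y(S)$ means $k(h_Y(S))$. For ideals $I,J$ of $R$, $I$ is an $\mathcal{H}_{YJ}$-ideal if $kh_Y(a)\cap J\subseteq I$ for every $a\in I$, and $I$ is a strong $\mathcal{H}_{YJ}$-ideal if $kh_Y(F)\cap J\subseteq I$ for every finite subset $F$ of $I$. An ideal $I$ is a relative (resp., relative strong) $\mathcal{H}_Y$-ideal if it is an $\mathcal{H}_{YJ}$-ideal (resp., a strong $\mathcal{H}_{YJ}$-ideal) for some ideal $J\not\subseteq I$. $\bigcap Y$ is the intersection of all members of $Y$. *)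

(* Defs.v *)
From mathcomp Require Import all_boot all_algebra.
From mathcomp Require Import classical_sets cardinality.

Set Implicit Arguments.
Unset Strict Implicit.
Unset Printing Implicit Defensive.

Import GRing.Theory.
Local Open Scope ring_scope.
Local Open Scope classical_set_scope.

(* Mathcomp's [idealr] predicates are boolean and proper by definition, on
   nontrivial rings only.  Here an ideal is a subset, possibly all of R, and R
   may be the zero ring. *)
Definition is_ideal (R : comPzRingType) (I : set R) : Prop :=
  [/\ I 0,
      forall x y, I x -> I y -> I (x + y)
    & forall r x, I x -> I (r * x)].

Definition is_proper_ideal (R : comPzRingType) (I : set R) : Prop :=
  is_ideal I /\ I <> setT.

Definition is_prime_ideal (R : comPzRingType) (P : set R) : Prop :=
  is_proper_ideal P /\ (forall x y, P (x * y) -> P x \/ P y).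

Definition Spec (R : comPzRingType) : set (set R) := [set P | is_prime_ideal P].

Definition von_neumann_regular (R : comPzRingType) : Prop :=
  forall a : R, exists b : R, a = a * b * a.

Definition hull (R : comPzRingType) (Y : set (set R)) (S : set R) :
    set (set R) :=
  [set P | Y P /\ S `<=` P].

(* The empty intersection is [setT], that is, k(emptyset) = R. *)
Definition kernel (R : comPzRingType) (T : set (set R)) : set R :=
  \bigcap_(P in T) P.

Definition HYJ_ideal (R : comPzRingType) (Y : set (set R)) (J I : set R) :
    Prop :=
  [/\ is_ideal I, is_ideal J
    & forall a, I a -> kernel (hull Y [set a]) `&` J `<=` I].

Definition strong_HYJ_ideal (R : comPzRingType) (Y : set (set R))
    (J I : set R) : Prop :=
  [/\ is_ideal I, is_ideal J
    & forall F : set R, finite_set F -> F `<=` I ->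
        kernel (hull Y F) `&` J `<=` I].

Definition relative_HY_ideal (R : comPzRingType) (Y : set (set R))
    (I : set R) : Prop :=
  exists J : set R, [/\ is_ideal J, ~ J `<=` I & HYJ_ideal Y J I].

Definition relative_strong_HY_ideal (R : comPzRingType) (Y : set (set R))
    (I : set R) : Prop :=
  exists J : set R, [/\ is_ideal J, ~ J `<=` I & strong_HYJ_ideal Y J I].

(* Main.v *)
Require Import Defs.
From mathcomp Require Import all_boot all_algebra.
From mathcomp Require Import boolp classical_sets cardinality.
From mathcomp Require Import ring.

(** A relative strong ideal is a relative ideal because singletons are finite,
    so the content is in the two remaining implications.

    If every proper ideal is relative and some [a] is not in [a^2 R], Zorn's
    lemma gives an ideal [I] containing [a^2] and maximal among those missing
    [a] ([exists_ideal_maximal_avoiding]).  Take [J] not inside [I] as in the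
    definition.  By maximality [a] is in [I + J], say [a = i + j].  Primes do
    not see the difference between [x] and [x^2], so [I] is closed under square
    roots inside [J] ([HYJ_ideal_sqr_closed]).  Applied to [a j], this gives
    [a j] in [I]; then [j^2 = a j - i j] is in [I], hence so is [j], and so is
    [a]: contradiction.

    If [R] is regular, [J = R] works for all proper ideals at once: a finite
    subset [F] of [I] is fixed by multiplication by some [e] in [I]
    ([regular_finite_unit]), that is, [1 - e] annihilates [F].  As the members
    of [Y] are primes with zero intersection, [1 - e] also annihilates the
    kernel of the hull of [F] ([kernel_hull_annihilator]), each element [x] of
    which is therefore [x e], an element of [I]. *)

Import GRing.Theory.
Local Open Scope ring_scope.
Local Open Scope classical_set_scope.

Section Ideals.
Context {R : comPzRingType}.
Implicit Types (I J D K : set R) (a x : R).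

Lemma ideal_opp I x : is_ideal I -> I x -> I (- x).
Proof. by case=> _ _ IM Ix; rewrite -mulN1r; exact: IM. Qed.

Lemma ideal_proper I a : is_ideal I -> ~ I a -> is_proper_ideal I.
Proof. by move=> idI nIa; split=> // IT; apply: nIa; rewrite IT. Qed.

Lemma ideal_principal a : is_ideal [set x | exists r, x = r * a].
Proof.
split=> [|_ _ [r ->] [s ->]|r _ [s ->]].
- by exists 0; rewrite mul0r.
- by exists (r + s); rewrite mulrDl.
- by exists (r * s); rewrite mulrA.
Qed.

Lemma ideal_sum I J : is_ideal I -> is_ideal J ->
  is_ideal [set x | exists i j, [/\ I i, J j & x = i + j]].
Proof.
move=> [I0 ID IM] [J0 JD JM]; split.
- by exists 0, 0; split; rewrite ?addr0.
- move=> _ _ [i [j [Ii Jj ->]]] [i' [j' [Ii' Jj' ->]]].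
  by exists (i + i'), (j + j'); split; [exact: ID | exact: JD | rewrite addrACA].
- move=> r _ [i [j [Ii Jj ->]]].
  by exists (r * i), (r * j); split; [exact: IM | exact: JM | rewrite mulrDr].
Qed.

(** The union of the empty chain is empty, hence not an ideal; so Zorn's lemma
    is applied to the sets [X] such that [D `|` X] is an ideal missing [a],
    rather than to the ideals containing [D]. *)
Lemma exists_ideal_maximal_avoiding D a : is_ideal D -> ~ D a ->
  exists I, [/\ is_ideal I, D `<=` I, ~ I a &
    forall K, is_ideal K -> I `<=` K -> ~ K a -> K `<=` I].
Proof.
move=> idD nDa.
pose avoids X := is_ideal (D `|` X) /\ ~ (D `|` X) a.
have [F Favoids Fchain|X [[idX nXa] maxX]] := @Zorn_bigcup _ avoids.
  pose U := D `|` \bigcup_(X in F) X; rewrite /avoids -/U.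
  have subU X : F X -> D `|` X `<=` U.
    by move=> FX x [Dx|Xx]; [left | right; exists X].
  have subD : D `<=` U by move=> x Dx; left.
  have directed x y : U x -> U y ->
      exists K, [/\ is_ideal K, K `<=` U, K x & K y].
    case=> [Dx|[X FX Xx]] [Dy|[Z FZ Zy]].
    - by exists D.
    - exists (D `|` Z); split; [by case: (Favoids Z FZ) | exact: subU | |].
      + by left.
      + by right.
    - exists (D `|` X); split; [by case: (Favoids X FX) | exact: subU | |].
      + by right.
      + by left.
    - case: (Fchain X Z FX FZ) => sub.
      + exists (D `|` Z); split;
          [by case: (Favoids Z FZ) | exact: subU | |]; right => //.
        exact: sub.
      + exists (D `|` X); split;
          [by case: (Favoids X FX) | exact: subU | |]; right => //.
        exact: sub.
  split; last first.
    by case=> // -[X FX Xa]; case: (Favoids X FX) => _; apply; right.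
  split.
  - by left; case: idD.
  - move=> x y Ux Uy; have [K [[_ KD _] KU Kx Ky]] := directed x y Ux Uy.
    by apply: KU; exact: KD.
  - move=> r x Ux; have [K [[_ _ KM] KU Kx _]] := directed x x Ux Ux.
    by apply: KU; exact: KM.
exists (D `|` X); split=> // K idK subK nKa x Kx.
apply: contrapT => nx; apply: (maxX K).
  split; first by move=> y Xy; apply: subK; right.
  by move=> KX; apply: nx; right; exact: KX.
suff DK : D `|` K = K by rewrite /avoids DK.
by apply/setUidPr => y Dy; apply: subK; left.
Qed.

(** Induction on [s].  If [f = f b f] then [1 - b f] kills [f], while [1 - e]
    kills the elements already treated; their product kills all of them, and it
    is [1 - e'] with [e'] again in [I]. *)
Lemma regular_finite_unit I (s : seq R) : von_neumann_regular R ->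
  is_ideal I -> [set` s] `<=` I ->
  exists2 e, I e & forall f, f \in s -> f * (1 - e) = 0.
Proof.
move=> regR idI; have [I0 ID IM] := idI.
elim: s => [|f s IHs] sI; first by exists 0.
have [|e Ie se] := IHs.
  by move=> x xs; apply: sI; rewrite /= inE [x \in s]xs orbT.
have If : I f by apply: sI; rewrite /= inE eqxx.
have [b fb] := regR f.
exists (1 - (1 - e) * (1 - b * f)).
  have -> : 1 - (1 - e) * (1 - b * f) = e + (1 - e) * b * f by ring.
  by apply: ID => //; exact: IM.
move=> g; rewrite inE subKr => /predU1P[->|/se gs]; last by rewrite mulrA gs mul0r.
have -> : f * ((1 - e) * (1 - b * f)) = (1 - e) * (f - f * b * f) by ring.
by rewrite -fb subrr mulr0.
Qed.

End Ideals.

Section Hulls.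
Context {R : comPzRingType} {Y : set (set R)} (Y_Spec : Y `<=` @Spec R).
Implicit Types (I J F : set R) (c x : R).

Lemma HYJ_ideal_sqr_closed {J I x} :
  HYJ_ideal Y J I -> J x -> I (x * x) -> I x.
Proof.
move=> [_ _ closedI] Jx Ixx; apply: (closedI (x * x) Ixx); split=> // P [YP Pxx].
by have [_ primeP] := Y_Spec _ YP; case: (primeP x x (Pxx _ erefl)).
Qed.

(** A member of [Y] either contains [F], and then [x], or misses some element
    of [F], and then contains [c] because it is prime.  So [x c] lies in every
    member of [Y]. *)
Lemma kernel_hull_annihilator F c x : \bigcap_(P in Y) P = [set 0] ->
  (forall f, F f -> f * c = 0) -> kernel (hull Y F) x -> x * c = 0.
Proof.
move=> capY Fc Fx; suff : (\bigcap_(P in Y) P) (x * c) by rewrite capY.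
move=> P YP; have [[[P0 _ PM] _] primeP] := Y_Spec _ YP.
have [FP|] := pselect (F `<=` P).
  by rewrite mulrC; apply: PM; apply: Fx.
move=> /existsNP[f /not_implyP[Ff nPf]].
have [//|Pc|Pc] := primeP f c; [by rewrite Fc | by [] | exact: PM].
Qed.

Lemma strong_relative_HY_ideal I :
  relative_strong_HY_ideal Y I -> relative_HY_ideal Y I.
Proof.
move=> [J [idJ JI [idI _ strongI]]]; exists J; split=> //; split=> // a Ia.
by apply: strongI; [exact: finite_set1 | move=> _ ->].
Qed.

Lemma relative_HY_ideals_regular :
  (forall I, is_proper_ideal I -> relative_HY_ideal Y I) ->
  von_neumann_regular R.
Proof.
move=> relY a; apply: contrapT => irreg_a.
have nDa : ~ [set x | exists r, x = r * (a * a)] a.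
  by move=> [b ab]; apply: irreg_a; exists b; rewrite {1}ab; ring.
have [I [idI DI nIa maxI]] :=
  exists_ideal_maximal_avoiding _ a (ideal_principal (a * a)) nDa.
have [J [idJ nJI relI]] := relY I (ideal_proper _ _ idI nIa).
have [I0 ID IM] := idI; have [J0 JD JM] := idJ.
have [i [j [Ii Jj a_ij]]] : exists i j, [/\ I i, J j & a = i + j].
  apply: contrapT => nIJa; apply: nJI => j Jj.
  apply: (maxI _ (ideal_sum _ _ idI idJ) _ nIJa).
    by move=> i Ii; exists i, 0; rewrite addr0.
  by exists 0, j; rewrite add0r.
(* The square of [a j] is a multiple of [a^2]. *)
have Iaj : I (a * j).
  apply: (HYJ_ideal_sqr_closed relI); first exact: JM.
  by apply: DI; exists (j * j); ring.
have Ij : I j.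
  apply: (HYJ_ideal_sqr_closed relI) => //.
  have -> : j * j = a * j + - (j * i) by rewrite a_ij; ring.
  by apply: ID => //; apply: ideal_opp => //; exact: IM.
by apply: nIa; rewrite a_ij; exact: ID.
Qed.

Lemma regular_relative_strong_HY_ideal I : \bigcap_(P in Y) P = [set 0] ->
  von_neumann_regular R -> is_proper_ideal I -> relative_strong_HY_ideal Y I.
Proof.
move=> capY regR [idI nIT]; exists setT; split=> //.
  by move=> IT; apply: nIT; apply/seteqP.
split=> // F /finite_seqP[s ->] sI x [sx _].
have [e Ie se] := regular_finite_unit _ _ regR idI sI.
have /eqP := kernel_hull_annihilator _ (1 - e) x capY se sx.
rewrite mulrBr mulr1 subr_eq0 => /eqP ->.
by case: idI => _ _; apply.
Qed.

End Hulls.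

Theorem theorem4p10 (R : comPzRingType) (Y : set (set R))
    (Y_Spec : Y `<=` @Spec R) (capY : \bigcap_(P in Y) P = [set 0]) :
  [<-> forall I : set R, is_proper_ideal I -> relative_strong_HY_ideal Y I;
       forall I : set R, is_proper_ideal I -> relative_HY_ideal Y I;
       von_neumann_regular R].
Proof.
tfae.
- by move=> strongY I /strongY; exact: strong_relative_HY_ideal.
- exact: relative_HY_ideals_regular.
- by move=> regR I; exact: regular_relative_strong_HY_ideal.
Qed.
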